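(* Let $\alpha\in(0,\frac12]$ and let $Z$ be the limit process. Then $Z$ is a centered Gaussian process with c\`adl\`ag paths. Its covariance function $\sigma(s,t):=\mathbb{E}[Z(t)Z(s)]$, $s,t\in[0,1]$, is given by $$\sigma(s,t)=\frac{\kappa^{j(s,t)+1}-2\kappa^{j(s,t)}+1}{1-\kappa},\qquad \kappa:=\left(\tfrac12\right)^{2-\alpha},$$ with the convention $\kappa^\infty:=0$. Equivalently, $$\mathbb{E}\left[(Z(t)-Z(s))^2\right]=\gamma\,\kappa^{j(s,t)},\qquad \gamma=\frac{4-2\kappa}{1-\kappa}.$$
   Context: Binary expansions: each $t\in[0,1)$ is written in binary as $t=\sum_{i\ge1}t_i2^{-i}$, $t_i\in\{0,1\}$, using the expansion in which $t_i=0$ for infinitely many $i$; and $1=\sum_{i\ge 1}2^{-i}$. For $u,v\in[0,1]$, $j(u,v):=\max\{j\ge1:(u_1,\dots,u_j)=(v_1,\dots,v_j)\}$ with $\max\emptyset:=0$, $\max\mathbb{N}:=\infty$. Limit process: let $\Theta:=\bigcup_{k\ge0}\{0,1\}^k$ be the set of finite $0$-$1$ words, $|\vartheta|$ the length of $\vartheta$, and $B_\vartheta\subset[0,1]$ the set of numbers whose binary expansion has prefix $\vartheta$. Let $\{N_\vartheta:\vartheta\in\Theta\}$ be independent standard normal random variables and, for $n\ge0$, $t\in[0,1]$, $$Z_n(t):=\sum_{\vartheta\in\Theta:\,|\vartheta|<n}\left(\tfrac12\right)^{(1-\alpha/2)|\vartheta|}\left(\mathbf{1}_{\{t\in B_{\vartheta0}\}}-\mathbf{1}_{\{t\in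 B_{\vartheta1}\}}\right)N_\vartheta .$$ The limit process $Z$ is the almost sure uniform limit of $(Z_n)_{n\ge0}$ on $[0,1]$ (this limit exists). *)

(* Defs.v *)
From HB Require Import structures.
From mathcomp Require Import all_boot all_order all_algebra.
From mathcomp Require Import all_classical all_reals all_analysis.
Import Order.TTheory GRing.Theory Num.Theory.
Import numFieldNormedType.Exports.

Set Implicit Arguments.
Unset Strict Implicit.
Unset Printing Implicit Defensive.

Local Open Scope classical_set_scope.
Local Open Scope ring_scope.

(** Binary expansions.  Sequences are indexed from 0: [b i] is the digit of
    weight [2 ^- i.+1], so [binexp t i] is the (i+1)-st binary digit of [t].
    For [t = 1] the only expansion is the constant sequence [true]. *)
Definition is_binexp (R : realType) (t : R) (b : nat -> bool) : Prop :=
  series (fun i => (b i)%:R * 2^-1 ^+ i.+1 : R) @ \oo --> t /\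
  (t < 1 -> forall n : nat, exists2 i : nat, (n <= i)%N & b i = false).

Definition binexp (R : realType) (t : R) : nat -> bool :=
  xget (fun=> false) [set b | is_binexp t b].

Definition agree (R : realType) (u v : R) : set nat :=
  [set j | (0 < j)%N /\ forall i, (i < j)%N -> binexp u i = binexp v i].

(** [jlen u v] is the maximum of [agree u v], where [None] stands for infinity
    (maximum of all positive integers) and the maximum of the empty set is 0. *)
Definition jlen (R : realType) (u v : R) : option nat :=
  if `[< agree u v = [set j | (0 < j)%N] >] then None
  else Some (xget 0%N (agree u v `&` ubound (agree u v))).

(** Powers with exponent in [option nat], [None] being infinity; only used for
    bases in [0, 1), whence the value 0 at infinity. *)
Definition powo (R : realType) (x : R) (j : option nat) : R :=
  if j is Some k then x ^+ k else 0.

Definition kappa (R : realType) (alpha : R) : R := 2^-1 `^ (2 - alpha).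

Definition gamma (R : realType) (alpha : R) : R :=
  (4 - 2 * kappa alpha) / (1 - kappa alpha).

(** Finite 0-1 words are sequences of booleans, [false] for 0, [true] for 1. *)
Definition cyl (R : realType) (w : seq bool) : set R :=
  [set t | 0 <= t <= 1 /\ mkseq (binexp t) (size w) = w].

Definition Zapprox (R : realType) (T : Type) (alpha : R)
    (N : seq bool -> T -> R) (n : nat) (t : R) (x : T) : R :=
  \sum_(k < n) \sum_(w : k.-tuple bool)
    2^-1 `^ ((1 - alpha / 2) * k%:R) *
    (\1_(cyl (rcons w false)) t - \1_(cyl (rcons w true)) t) * N w x.

(** Mutual independence: the product rule over every finite subfamily. *)
Definition mutually_independent d (T : measurableType d) (R : realType)
    (P : probability T R) (I : eqType) (X : I -> {RV P >-> R}) : Prop :=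
  forall (J : seq I) (A : I -> set R), uniq J ->
    (forall i, measurable (A i)) ->
    P (\big[setI/setT]_(i <- J) (X i @^-1` A i)) =
    (\prod_(i <- J) P (X i @^-1` A i))%E.

(** Laws are compared on measurable sets only: the values of set functions such
    as [normal_prob] on other sets are meaningless. *)
Definition has_law d (T : measurableType d) (R : realType)
    (P : probability T R) (X : T -> R) (mu : set R -> \bar R) : Prop :=
  forall A : set R, measurable A -> pushforward P X A = mu A.

(** The second parameter of [normal_prob] is the standard deviation, and
    [normal_prob m 0] is the uniform law on [0, 1]: degenerate Gaussian laws
    have to be listed separately, as Dirac masses. *)
Definition gaussian_RV d (T : measurableType d) (R : realType)
    (P : probability T R) (X : T -> R) : Prop :=
  exists m : R, has_law P X \d_m \/
    exists2 s : R, 0 < s & has_law P X (normal_prob m s).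

(** A process on [0, 1] is Gaussian if every finite-dimensional marginal is
    multivariate normal (possibly degenerate), i.e. if all finite linear
    combinations of its coordinates are Gaussian.  Here and below, processes on
    [0, 1] are indexed by [R] and only their values on [0, 1] matter. *)
Definition gaussian_process d (T : measurableType d) (R : realType)
    (P : probability T R) (Z : R -> {RV P >-> R}) : Prop :=
  forall (n : nat) (t a : 'I_n -> R), (forall i, 0 <= t i <= 1) ->
    gaussian_RV P (fun x => \sum_(i < n) a i * Z (t i) x).

Definition centered_process d (T : measurableType d) (R : realType)
    (P : probability T R) (Z : R -> {RV P >-> R}) : Prop :=
  forall t : R, 0 <= t <= 1 -> 'E_P[Z t]%E = 0%E.

Definition cadlag (R : realType) (f : R -> R) : Prop :=
  (forall t, 0 <= t < 1 -> f s @[s --> t^'+] --> f t) /\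
  (forall t, 0 < t <= 1 -> cvg (f s @[s --> t^'-])).

Definition limit_process d (T : measurableType d) (R : realType)
    (P : probability T R) (alpha : R) (N : seq bool -> {RV P >-> R})
    (Z : R -> {RV P >-> R}) : Prop :=
  {ae P, forall x, {uniform `[0%R, 1%R],
    (fun n (t : R) => Zapprox alpha N n t x) @ \oo --> (fun t => Z t x)}}.

(* Main.v *)
(** A linear combination of values of the truncated series is a finite linear
    combination of the independent variables [N w], hence centered Gaussian with
    variance the sum of the squared coefficients; this variance converges because
    two points [s], [t] share exactly the cylinders of length at most [jlen s t],
    with opposite signs on the last one.  Centered Gaussian laws pass to almost
    sure limits when their variances converge, so all linear combinations of the
    limit process are centered Gaussian with explicit variance; the covariance
    follows by polarization, without any L2 convergence.  For fixed [n] the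
    truncated series is constant on each side of a point near that point, which
    gives the path regularity of the uniform limit. *)
From HB Require Import structures.
Require Import Defs.
From mathcomp Require Import all_boot all_order all_algebra.
From mathcomp Require Import all_classical all_reals all_analysis.
From mathcomp Require Import measurable_realfun zify ring lra.
Import Order.TTheory GRing.Theory Num.Theory.
Import numFieldNormedType.Exports.
Local Open Scope classical_set_scope.
Local Open Scope ring_scope.

Set Implicit Arguments.
Unset Strict Implicit.
Unset Printing Implicit Defensive.

(** * Densities of normal laws and affine changes of variables *)

(** The Radon-Nikodym derivative of the normal law and [normal_pdf] have the same integral over
    every measurable set, hence agree almost everywhere. This reduces Gaussian integrals to Lebesgue
    integrals. *)
Lemma integral_normal_prob (R : realType) (m s : R) (f : R -> \bar R) :
  measurable_fun [set: R] f -> (forall x, 0 <= f x)%E ->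
  (\int[normal_prob m s]_x f x =
   \int[lebesgue_measure]_x (f x * (normal_pdf m s x)%:E))%E.
Proof.
move=> mf f0.
have dom := normal_prob_dominates m s.
have mpdf : measurable_fun [set: R] (fun x => (normal_pdf m s x)%:E).
  by apply/measurable_EFinP; exact: measurable_normal_pdf.
have mRN : measurable_fun [set: R]
    (Radon_Nikodym_SigmaFinite.f (normal_prob m s) (@lebesgue_measure R)).
  exact: measurable_int (Radon_Nikodym_SigmaFinite.f_integrable dom).
rewrite -(Radon_Nikodym_SigmaFinite.change_of_variables dom)//.
apply: ae_eq_integral => //; [exact: emeasurable_funM|exact: emeasurable_funM|].
apply: ae_eqe_mul2l; apply: integral_ae_eq => //.
  exact: Radon_Nikodym_SigmaFinite.f_integrable.
by move=> E _ mE; rewrite -Radon_Nikodym_SigmaFinite.f_integral.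
Qed.

Section affine_change_of_variables.
Context {R : realType}.
Local Notation mu := (@lebesgue_measure R).
Implicit Types (a b : R) (A : set R).

Let affine a b : measurableTypeR R -> measurableTypeR R := fun x => a * x + b.

Let measurable_affine a b : measurable_fun setT (affine a b).
Proof. by apply: measurable_funD => //; exact: measurable_funM. Qed.

Let image_affine a b : {measure set (measurableTypeR R) -> \bar R}.
Proof. by refine (pushforward mu (affine a b)); exact: measurable_affine. Defined.

(** By uniqueness of Lebesgue measure it suffices to compare lengths of half-open intervals. A
    negative [a] reverses the interval and moves its open end to the other side, hence the two
    cases. *)
Lemma lebesgue_measure_affine a b A : a != 0 -> measurable A ->
  (mu A = `|a|%:E * mu ((fun x => a * x + b)%R @^-1` A))%E.
Proof.
move=> a0 mA.
pose k : {nonneg R} := NngNum (normr_ge0 a).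
transitivity (mscale k (image_affine a b) A); last by [].
apply: lebesgue_measure_unique => // _ [[u v]] _ <-.
change (mu `]u, v] = (`|a|%:E * mu (affine a b @^-1` `]u, v]))%E).
have [agt0|alt0|] := ltgtP 0 a; last by move=> /esym/eqP; rewrite (negPf a0).
- rewrite (_ : _ @^-1` _ = `](u - b) / a, (v - b) / a]%classic); last first.
    apply/seteqP; split=> x; rewrite /affine/= !in_itv/= ltr_pdivrMr//
      ler_pdivlMr// ltrBlDr lerBrDr (mulrC x)//.
  rewrite !lebesgue_measure_itv/= !lte_fin ltr_pM2r ?invr_gt0// ltrD2r.
  rewrite gtr0_norm//; case: ifPn => _; last by rewrite mule0.
  by rewrite -!EFinB -EFinM; congr EFin; field.
- rewrite (_ : _ @^-1` _ = `[(v - b) / a, (u - b) / a[%classic); last first.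
    apply/seteqP; split=> x; rewrite /affine/= !in_itv/= ler_ndivrMr//
      ltr_ndivlMr// ltrBlDr lerBrDr (mulrC x) andbC//.
  rewrite !lebesgue_measure_itv/= !lte_fin ltr_nM2r ?invr_lt0// ltrD2r.
  rewrite ltr0_norm//; case: ifPn => _; last by rewrite mule0.
  by rewrite -!EFinB -EFinM; congr EFin; field.
Qed.

Lemma ge0_integral_affine a b (f : R -> \bar R) : a != 0 ->
  measurable_fun [set: R] f -> (forall x, 0 <= f x)%E ->
  (\int[mu]_x f x = `|a|%:E * \int[mu]_x f (a * x + b)%R)%E.
Proof.
move=> a0 mf f0.
pose k : {nonneg R} := NngNum (normr_ge0 a).
transitivity (\int[mscale k (image_affine a b)]_x f x)%E.
  by apply: eq_measure_integral => A mA _; exact: lebesgue_measure_affine.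
rewrite ge0_integral_mscale//=; congr (_ * _)%E; exact: ge0_integral_pushforward.
Qed.

End affine_change_of_variables.

(** * Centered Gaussian laws, degenerate case included, and their convolution *)

(** Named so that it can carry the structure of measurable function from which [distribution] builds
    [gauss_law]. *)
Definition homothety {R : realType} (s : R) :
  measurableTypeR R -> measurableTypeR R := fun z => s * z.

Lemma measurable_homothety {R : realType} (s : R) :
  measurable_fun setT (homothety s).
Proof. exact: measurable_funM. Qed.

HB.instance Definition _ (R : realType) (s : R) :=
  isMeasurableFun.Build _ _ _ _ (homothety s) (measurable_homothety s).

(** The law of [s] times a standard normal variable: it is a Dirac mass at
    [s = 0], where [normal_prob 0 s] is a uniform law. *)
Definition gauss_law {R : realType} (s : R) :=
  distribution (normal_prob 0 1) (homothety s).

HB.instance Definition _ (R : realType) (s : R) :=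
  Probability.on (gauss_law s).

Section gauss_law.
Context {R : realType}.
Local Notation mu := (@lebesgue_measure R).
Implicit Types (s b : R) (A : set R).

Lemma normal_prob_integral_indic (m s : R) (A : set R) : measurable A ->
  (normal_prob m s A =
   \int[mu]_x ((\1_A x)%:E * (normal_pdf m s x)%:E))%E.
Proof.
move=> mA; rewrite -[RHS]integral_normal_prob ?integral_indic ?setIT//.
exact/measurable_EFinP/measurable_indic.
Qed.

Lemma gauss_lawE s A :
  gauss_law s A = normal_prob 0 1 ((fun z => s * z) @^-1` A).
Proof. by []. Qed.

Lemma ge0_integral_gauss_law s (f : R -> \bar R) :
  measurable_fun [set: R] f -> (forall x, 0 <= f x)%E ->
  (\int[gauss_law s]_x f x = \int[normal_prob 0 1]_z f (s * z)%R)%E.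
Proof. by move=> mf f0; rewrite ge0_integral_distribution. Qed.

Lemma measurable_mul_preimage s A : measurable A ->
  measurable ((fun z : R => s * z) @^-1` A).
Proof.
by move=> mA; rewrite -[X in measurable X]setTI; exact: measurable_funM.
Qed.

Lemma gauss_law0 A : measurable A -> gauss_law 0 A = \d_(0 : R) A.
Proof.
move=> mA; rewrite gauss_lawE diracE.
have [A0|A0] := boolP (0 \in A).
- rewrite (_ : _ @^-1` _ = setT) ?probability_setT//.
  by apply/seteqP; split=> // z _; rewrite /= mul0r; exact: set_mem.
- rewrite (_ : _ @^-1` _ = set0) ?measure0//.
  apply/seteqP; split=> // z; rewrite /= mul0r => /mem_set; exact/negP.
Qed.

Lemma normal_pdf01E (x : R) :
  normal_pdf 0 1 x = normal_peak 1 * expR (- x ^+ 2 / 2).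
Proof.
by rewrite normal_pdfE ?oner_eq0// /normal_fun subr0 expr1n.
Qed.

Let mpdf : measurable_fun [set: R] (fun x => (normal_pdf (0:R) 1 x)%:E).
Proof. by apply/measurable_EFinP; exact: measurable_normal_pdf. Qed.

(** Substituting [x = s * z] in the density of standard deviation [s] produces a factor [s] that
    cancels the one in the peak. *)
Lemma gauss_law_normal s A : 0 < s -> measurable A ->
  gauss_law s A = normal_prob 0 s A.
Proof.
move=> s0 mA; have sN0 : s != 0 by rewrite gt_eqF.
rewrite gauss_lawE normal_prob_integral_indic; last exact: measurable_mul_preimage.
rewrite [RHS]normal_prob_integral_indic; last exact: mA.
rewrite [RHS](@ge0_integral_affine R s 0)//; first last.
- by move=> x; rewrite mule_ge0// lee_fin normal_pdf_ge0.
- apply: emeasurable_funM; first exact/measurable_EFinP/measurable_indic.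
  by apply/measurable_EFinP; exact: measurable_normal_pdf.
rewrite -ge0_integralZl//; first last.
- by move=> x _; rewrite mule_ge0// lee_fin normal_pdf_ge0.
- apply: emeasurable_funM.
    apply/measurable_EFinP; apply: measurableT_comp => //.
    by apply: measurable_funD => //; exact: measurable_funM.
  apply/measurable_EFinP; apply: measurableT_comp; first exact: measurable_normal_pdf.
  by apply: measurable_funD => //; exact: measurable_funM.
apply: eq_integral => x _; rewrite addr0 -!EFinM; congr EFin.
rewrite mulrCA; congr (_ * _).
rewrite normal_pdf01E normal_pdfE// /normal_fun subr0 mulrA; congr (_ * expR _).
  rewrite /normal_peak expr1n mul1r -mulrnAr sqrtrM ?sqr_ge0// sqrtr_sqr.
  by rewrite invfM mulrA divff ?mul1r// gt_eqF// normr_gt0.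
by field.
Qed.

(** The left side is the law of [s * U + b * Y] for independent standard normal [U] and [Y],
    computed conditionally on [U]. The substitution [y = c / b * z - s / b * u] turns
    [s * u + b * y] into [c * z]; after the symmetry of the joint density is used, [u] integrates
    out. *)
Lemma gauss_convolution s b A : b != 0 -> measurable A ->
  (\int[normal_prob 0 1]_u normal_prob 0 1 [set y | A (s * u + b * y)%R] =
   gauss_law (Num.sqrt (s ^+ 2 + b ^+ 2)) A)%E.
Proof.
move=> b0 mA; set c := Num.sqrt _.
have c2 : c ^+ 2 = s ^+ 2 + b ^+ 2 by rewrite sqr_sqrtr// addr_ge0// sqr_ge0.
have b2 : 0 < b ^+ 2 by rewrite exprn_even_gt0.
have c0 : 0 < c by rewrite sqrtr_gt0 ltr_wpDl// sqr_ge0.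
have cb0 : c / b != 0 by rewrite mulf_neq0 ?invr_eq0// gt_eqF.
pose phi (x : R) := (normal_pdf 0 1 x)%:E.
have phi_ge0 x : (0 <= phi x)%E by rewrite lee_fin normal_pdf_ge0.
(* This is invariance of the standard plane Gaussian under the orthogonal map
   exchanging [(u, (c z - s u) / b)] and [(z, (c u - s z) / b)]. *)
have phiM u z : (phi u * phi (c / b * z + - s / b * u)%R =
    phi z * phi (c / b * u + - s / b * z)%R)%E.
  rewrite /phi -!EFinM !normal_pdf01E; congr EFin.
  rewrite mulrACA [RHS]mulrACA -!expRD; congr (_ * expR _).
  have -> : (c / b * z + - s / b * u) ^+ 2 =
      (c ^+ 2 * z ^+ 2 - 2 * c * z * s * u + s ^+ 2 * u ^+ 2) / b ^+ 2 by field.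
  have -> : (c / b * u + - s / b * z) ^+ 2 =
      (c ^+ 2 * u ^+ 2 - 2 * c * z * s * u + s ^+ 2 * z ^+ 2) / b ^+ 2 by field.
  by rewrite c2; field.
have mlin (p q : R) : measurable_fun [set: R] (fun x => p * x + q).
  by apply: measurable_funD => //; exact: measurable_funM.
have mA2 : measurable [set p : R * R | A (s * p.1 + b * p.2)%R].
  rewrite -[X in measurable X]setTI.
  apply: (_ : measurable_fun setT (fun p : R * R => s * p.1 + b * p.2)) => //.
  by apply: measurable_funD; apply: measurable_funM.
have mA1 u : measurable [set y | A (s * u + b * y)%R].
  rewrite (_ : [set y | _] = xsection [set p : R * R | A (s * p.1 + b * p.2)%R] u).
    exact: measurable_xsection.
  by apply/seteqP; split => y; rewrite /xsection/= inE.
have mindic u : measurable_fun [set: R]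
    (fun y => (\1_[set y | A (s * u + b * y)%R] y : R)%:E).
  exact/measurable_EFinP/measurable_indic.
have mG : measurable_fun [set: R]
    (fun u => normal_prob 0 1 [set y | A (s * u + b * y)%R]).
  have := measurable_fun_xsection (normal_prob (0 : R) 1) mA2.
  apply: eq_measurable_fun => u _ /=; congr (normal_prob 0 1 _).
  by apply/seteqP; split => y; rewrite /xsection/= inE.
pose F (p : R * R) : \bar R :=
  ((\1_A (c * p.2))%:E * (phi p.2 * phi (c / b * p.1 + - s / b * p.2)%R))%E.
have F_ge0 p : (0 <= F p)%E by rewrite !mule_ge0.
have mF : measurable_fun [set: R * R] F.
  apply: emeasurable_funM.
    apply/measurable_EFinP; apply: (measurableT_comp (measurable_indic mA)).
    by apply: measurable_funM => //; exact: measurable_snd.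
  apply: emeasurable_funM.
    by apply: measurableT_comp mpdf _; exact: measurable_snd.
  apply: measurableT_comp mpdf _; apply: measurable_funD => //.
    by apply: measurable_funM => //; exact: measurable_fst.
  by apply: measurable_funM => //; exact: measurable_snd.
have FM u z : z \in [set: R] ->
    (phi u * ((\1_[set y | A (s * u + b * y)%R] (c / b * z + - s / b * u)%R)%:E *
      phi (c / b * z + - s / b * u)%R) = F (u, z))%E.
  move=> _; rewrite muleCA phiM /F/=; congr (_ * _)%E.
  rewrite !indicE; congr (_%:R%:E); congr (nat_of_bool _).
  apply/idP/idP => /set_mem H; apply/mem_set; move: H => /=; congr A; by field.
have FE u : (normal_prob 0 1 [set y | A (s * u + b * y)%R] * phi u =
   `|c / b|%:E * \int[mu]_z F (u, z))%E.
  rewrite normal_prob_integral_indic//.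
  rewrite (@ge0_integral_affine R (c / b) (- s / b * u))//; first last.
    by move=> y; rewrite mule_ge0 ?phi_ge0.
    exact: emeasurable_funM.
  rewrite -muleA; congr (_ * _)%E.
  rewrite muleC -ge0_integralZl; [|by []|..]; last exact: phi_ge0.
  - by apply: eq_integral; exact: FM.
  - by apply: emeasurable_funM; [exact: (measurableT_comp (mindic u) (mlin _ _))|
      exact: measurableT_comp mpdf (mlin _ _)].
  - by move=> y _; rewrite mule_ge0 ?phi_ge0.
rewrite integral_normal_prob//.
under eq_integral do rewrite FE.
rewrite ge0_integralZl//; last 2 first.
  exact: measurable_fun_fubini_tonelli_F.
  by move=> x _; exact: integral_ge0.
rewrite fubini_tonelli// -ge0_integralZl//; last 2 first.
  exact: measurable_fun_fubini_tonelli_G.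
  by move=> x _; exact: integral_ge0.
rewrite gauss_lawE normal_prob_integral_indic//; last exact: measurable_mul_preimage.
apply: eq_integral => z _; rewrite /F/=.
under eq_integral do rewrite muleA.
rewrite ge0_integralZl//; last 2 first.
  exact: measurableT_comp mpdf (mlin _ _).
  by rewrite mule_ge0 ?phi_ge0.
(* The factor [|c / b|] is the Jacobian that turns the integral over [u] into the total mass of the
   density, namely 1. *)
rewrite muleCA -ge0_integral_affine// /phi integral_normal_pdf mule1.
by rewrite !indicE.
Qed.

End gauss_law.

(** * Linear combinations of independent standard normal variables *)

Section independent_gaussian_sum.
Context d (T : measurableType d) (R : realType) (P : probability T R).
Context (I : eqType) (X : I -> {RV P >-> R}).
Hypothesis lawX : forall i, has_law P (X i) (normal_prob 0 1).
Hypothesis indX : mutually_independent X.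

(** The event indexed by [K] carries the independence of the partial sum from
    the remaining variables through the induction on [J]. *)
Lemma gaussian_sum_independent (J K : seq I) (a : I -> R) (B : I -> set R)
    (A : set R) :
  uniq (J ++ K) -> (forall i, measurable (B i)) -> measurable A ->
  (P ((fun x => (\sum_(i <- J) a i * X i x)%R) @^-1` A `&`
      \big[setI/setT]_(i <- K) (X i @^-1` B i)) =
   gauss_law (Num.sqrt (\sum_(i <- J) a i ^+ 2)) A *
   P (\big[setI/setT]_(i <- K) (X i @^-1` B i)))%E.
Proof.
elim: J K B A => [|j J IH] K B A /=.
  move=> _ _ mA; rewrite big_nil sqrtr0 gauss_law0// diracE.
  under [X in X @^-1` _]eq_fun do rewrite big_nil.
  have [A0|A0] := boolP (0 \in A).
  - rewrite (_ : _ @^-1` _ = setT) ?setTI ?mul1e//.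
    by apply/seteqP; split=> // z _; exact: set_mem.
  - rewrite (_ : _ @^-1` _ = set0) ?set0I ?measure0 ?mul0e//.
    by apply/seteqP; split=> // z /mem_set; exact/negP.
move=> /andP[jJK uJK] mB mA.
(* A zero coefficient is dropped first: [gauss_convolution] divides by it. *)
have [aj0|aj0] := eqVneq (a j) 0.
  have -> : (fun x => \sum_(i <- j :: J) a i * X i x)%R =
      (fun x => \sum_(i <- J) a i * X i x)%R.
    by apply/funext => x; rewrite big_cons aj0 mul0r add0r.
  by rewrite big_cons aj0 expr0n/= add0r IH.
set E := \big[setI/setT]_(i <- K) _.
have mX i (C : set R) : measurable C -> measurable (X i @^-1` C).
  by move=> mC; exact: measurable_funPTI.
have mE : measurable E by apply: bigsetI_measurable => i _; exact: mX.
pose S x := \sum_(i <- J) a i * X i x.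
have mS : measurable_fun setT S.
  by apply: measurable_sum => i; exact: measurable_funM.
set s := Num.sqrt (\sum_(i <- J) a i ^+ 2) in IH *.
have PE : P E \is a fin_num by exact: fin_num_measure.
pose k : {nonneg R} := NngNum (fine_ge0 (measure_ge0 P E)).
have kE : (k%:num)%:E = P E by rewrite /= fineK.
pose SX x : measurableTypeR R * measurableTypeR R := (S x, X j x).
have mS' : measurable_fun setT (S : T -> measurableTypeR R) := mS.
have mX' : measurable_fun setT (X j : T -> measurableTypeR R) :=
  measurable_funPT (X j).
have mSX : measurable_fun setT SX.
  exact: measurable_fun_pair mS' mX'.
(* [nu] is the law of the pair formed by the partial sum over [J] and [X j], restricted to the event
   [E]. It is a product measure as soon as it factorizes on rectangles. *)
have @nu : {measure set (measurableTypeR R * measurableTypeR R) -> \bar R}.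
  by refine (pushforward (mrestr P mE) SX).
have uK : uniq (j :: K).
  rewrite /= mem_cat negb_or in jJK *; case/andP: jJK => _ ->.
  by move: uJK; rewrite cat_uniq => /and3P[].
have nuX (A1 A2 : set R) : measurable A1 -> measurable A2 ->
    nu (A1 `*` A2) = (mscale k (gauss_law s) A1 * normal_prob 0 1 A2)%E.
  (* The event on [X j] joins the side event: the induction hypothesis is applied to [j :: K], with
     the set of index [j] replaced by [A2]. The other sets are unchanged on [K] because [j] is not
     in [K]. *)
  move=> mA1 mA2; pose B' i := if i == j then A2 else B i.
  have mB' i : measurable (B' i) by rewrite /B'; case: ifP.
  have EB' : \big[setI/setT]_(i <- K) (X i @^-1` B' i) = E.
    apply: eq_big_seq => i iK; rewrite /B'; case: eqP => // ij.
    by move: uK; rewrite /= -ij iK.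
  have uJjK : uniq (J ++ j :: K) by rewrite -cat1s uniq_catCA cat1s /= jJK.
  have B'j : B' j = A2 by rewrite /B' eqxx.
  have PK := @indX K B' _ mB'; rewrite EB' in PK.
  have PjK := @indX (j :: K) B' uK mB'.
  rewrite !big_cons -PK ?EB' ?B'j in PjK; last by case/andP: uK.
  have SjK := IH (j :: K) B' A1 uJjK mB' mA1.
  rewrite !big_cons EB' B'j PjK in SjK.
  have -> : nu (A1 `*` A2) = P (S @^-1` A1 `&` (X j @^-1` A2 `&` E)).
    by rewrite setIA.
  rewrite SjK -(lawX j mA2) -kE.
  by rewrite (muleC (P _)) muleA (muleC (gauss_law s A1)).
pose C := [set p : measurableTypeR R * measurableTypeR R | A (p.1 + a j * p.2)].
have mC : measurable C.
  rewrite -[X in measurable X]setTI.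
  apply: (_ : measurable_fun setT (fun p : measurableTypeR R * measurableTypeR R
    => p.1 + a j * p.2)) => //.
  by apply: measurable_funD => //; exact: measurable_funM.
transitivity (nu C).
  rewrite /nu/= /pushforward /mrestr; congr (P (_ `&` E)).
  by apply/seteqP; split=> x; rewrite /C /SX /S/= big_cons addrC.
rewrite -(@product_measure_unique _ _ (measurableTypeR R) (measurableTypeR R) R
  (mscale k (gauss_law s)) (normal_prob 0 1) nu nuX C mC) /product_measure1.
rewrite ge0_integral_mscale//; last exact: measurable_fun_xsection.
rewrite kE muleC ge0_integral_gauss_law//; last exact: measurable_fun_xsection.
congr (_ * _)%E.
transitivity (gauss_law (Num.sqrt (s ^+ 2 + (a j) ^+ 2)) A); last first.
  rewrite big_cons [X in _ = gauss_law (Num.sqrt X) _]addrC sqr_sqrtr//.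
  by apply: sumr_ge0 => i _; exact: sqr_ge0.
rewrite -(gauss_convolution s aj0 mA); apply: eq_integral => u _.
by congr (normal_prob 0 1 _); apply/seteqP; split => y; rewrite /xsection/= inE.
Qed.

Lemma gaussian_sum_law (J : seq I) (a : I -> R) : uniq J ->
  has_law P (fun x => \sum_(i <- J) a i * X i x)
    (gauss_law (Num.sqrt (\sum_(i <- J) a i ^+ 2))).
Proof.
move=> uJ A mA.
have := @gaussian_sum_independent J [::] a (fun=> setT) A.
by rewrite cats0 big_nil setIT probability_setT mule1; exact.
Qed.

End independent_gaussian_sum.

(** * Laws of almost sure limits *)

Lemma bounded_cvg_integral d (T : measurableType d) (R : realType)
    (P : probability T R) (f_ : nat -> T -> R) (f : T -> R) :
  (forall n, measurable_fun setT (f_ n)) -> measurable_fun setT f ->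
  (forall n x, 0 <= f_ n x <= 1) ->
  {ae P, forall x, f_ n x @[n --> \oo] --> f x} ->
  (\int[P]_x (f_ n x)%:E @[n --> \oo] --> \int[P]_x (f x)%:E)%E.
Proof.
move=> mf_ mf f_01 f_f.
have [] := @dominated_convergence _ T R P setT measurableT
  (fun n x => (f_ n x)%:E) (fun x => (f x)%:E) (cst 1%E).
- by move=> n; apply/measurable_EFinP; exact: mf_.
- by apply/measurable_EFinP; exact: mf.
- apply: filterS f_f => x f_fx _; by apply: cvg_EFin => //; exact: nearW.
- exact: finite_measure_integrable_cst.
- apply: nearW => x n _; have /andP[? ?] := f_01 n x.
  by rewrite /= ger0_norm// lee_fin.
by [].
Qed.

Lemma ge0_integral_has_law d (T : measurableType d) (R : realType)
    (P : probability T R) (X : T -> R)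
    (Q : {measure set (measurableTypeR R) -> \bar R}) (h : R -> \bar R) :
  measurable_fun setT X -> has_law P X Q ->
  measurable_fun [set: R] h -> (forall x, 0 <= h x)%E ->
  (\int[P]_x h (X x) = \int[Q]_x h x)%E.
Proof.
move=> mX lawX mh h0.
have @nu : {measure set (measurableTypeR R) -> \bar R}.
  by refine (pushforward P (X : T -> measurableTypeR R)).
transitivity (\int[nu]_x h x)%E.
  by rewrite ge0_integral_pushforward.
by apply: eq_measure_integral => A mA _; exact: lawX.
Qed.

(** The continuous ramps [h a k] tend pointwise to the indicator of the open half-line below [a], so
    both measures agree on these half-lines. Open half-lines are stable under intersection, generate
    the Borel sets and cover the line, so the measures are equal. *)
Lemma has_law_continuous d (T : measurableType d) (R : realType)
    (P : probability T R) (X : T -> R) (Q : probability (measurableTypeR R) R) :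
  measurable_fun setT X ->
  (forall h : R -> R, continuous h -> (forall x, 0 <= h x <= 1) ->
    (\int[P]_x (h (X x))%:E = \int[Q]_x (h x)%:E)%E) ->
  has_law P X Q.
Proof.
move=> mX Xh.
have @nu : {measure set (measurableTypeR R) -> \bar R}.
  by refine (pushforward P (X : T -> measurableTypeR R)).
pose h (a : R) (k : nat) (x : R) : R := Num.min 1 (Num.max 0 (k%:R * (a - x))).
have ch a k : continuous (h a k).
  have cl : continuous (fun x : R => k%:R * (a - x)).
    move=> x; apply: cvgM; first exact: cvg_cst.
    by apply: cvgB; [exact: cvg_cst|exact: cvg_id].
  move=> x; apply: (@continuous_min R R (cst 1) _ x); first exact: cst_continuous.
  by apply: (@continuous_max R R (cst 0) _ x); [exact: cst_continuous|exact: cl].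
have h01 a k x : 0 <= h a k x <= 1.
  by rewrite /h le_min ler01 le_max lexx ge_min lexx.
have hcvg a x : h a k x @[k --> \oo] --> (\1_(`]-oo, a[%classic) x : R).
  have [xa|ax] := ltP x a.
    rewrite indicE mem_set/= ?in_itv//=; apply: cvg_near_cst.
    near=> k; have : (a - x)^-1 <= k%:R by near: k; exact: nbhs_infty_ger.
    rewrite /h -[leLHS]mul1r ler_pdivrMr ?subr_gt0// => ka.
    by rewrite max_r ?min_l// (le_trans ler01).
  rewrite indicE memNset/= ?in_itv/= ?ltNge ?ax//; apply: cvg_near_cst.
  apply: nearW => k; rewrite /h max_l ?min_r//.
  by rewrite mulr_ge0_le0// subr_le0.
have mh a k : measurable_fun [set: R] (h a k) by exact: continuous_measurable_fun.
have Qlim a : (\int[Q]_x (h a k x)%:E @[k --> \oo] --> Q `]-oo, a[%classic)%E.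
  have <- : (\int[Q]_x (\1_(`]-oo, a[%classic) x)%:E = Q `]-oo, a[%classic)%E.
    by rewrite integral_indic ?setIT.
  apply: bounded_cvg_integral => //; first by move=> n; exact: mh.
  by apply: nearW => x; exact: hcvg.
have Plim a : (\int[Q]_x (h a k x)%:E @[k --> \oo] --> nu `]-oo, a[%classic)%E.
  have <- : (\int[P]_x (\1_(`]-oo, a[%classic) (X x))%:E = nu `]-oo, a[%classic)%E.
    transitivity (\int[P]_x (\1_(X @^-1` `]-oo, a[) x)%:E)%E; first by [].
    rewrite integral_indic ?setIT//.
    by rewrite -[X in measurable X]setTI; exact: (mX).
  rewrite (_ : (fun k => _) = (fun k => \int[P]_x (h a k (X x))%:E)%E); last first.
    by apply/funext => k; rewrite Xh.
  apply: bounded_cvg_integral => //.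
  - by move=> n; apply: measurableT_comp (mh a n) mX.
  - exact: measurableT_comp.
  - by apply: nearW => x; exact: hcvg.
move=> A mA.
apply: (@measure_unique _ R (measurableTypeR R) (@RGenInftyO.G R)
  (fun n => `]-oo, n%:R[%classic) _ _ _ _ nu Q _ _ A mA).
- exact: RGenInftyO.measurableE.
- move=> _ _ [x ->] [y ->]; exists (Num.min x y).
  by apply/seteqP; split=> z /=; rewrite !in_itv/= lt_min => /andP.
- by move=> n; exists n%:R.
- apply/seteqP; split=> // x _; exists (Num.truncn x).+1 => //=.
  by rewrite in_itv/= truncnS_gt.
- by move=> _ [x ->]; exact: (cvg_unique _ (Plim x) (Qlim x)).
- move=> n; rewrite /nu /= /pushforward (le_lt_trans (probability_le1 _ _)) ?ltry//.
  by rewrite -[X in measurable X]setTI; exact: (mX).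
Unshelve. all: by end_near. Qed.

(** For a bounded continuous [h], the expectation of [h (S_ n x)] has two limits: one from the
    almost sure convergence, the other from [s_ n * z] tending to [s * z] on the standard normal
    space. Scaling a fixed variable treats [s = 0] like any other value. *)
Lemma gaussian_law_limit d (T : measurableType d) (R : realType)
    (P : probability T R) (S_ : nat -> T -> R) (S : T -> R)
    (s_ : nat -> R) (s : R) :
  (forall n, measurable_fun setT (S_ n)) -> measurable_fun setT S ->
  (forall n, has_law P (S_ n) (gauss_law (s_ n))) ->
  s_ n @[n --> \oo] --> s ->
  {ae P, forall x, S_ n x @[n --> \oo] --> S x} ->
  has_law P S (gauss_law s).
Proof.
move=> mS_ mS lawS_ s_s S_S; apply: has_law_continuous => // h ch h01.
have mh : measurable_fun [set: R] h by exact: continuous_measurable_fun.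
have h0 x : (0 <= (h x)%:E)%E by rewrite lee_fin; case/andP: (h01 x).
have mhE : measurable_fun [set: R] (fun x => (h x)%:E) by exact/measurable_EFinP.
have limS : (\int[P]_x (h (S_ n x))%:E @[n --> \oo] --> \int[P]_x (h (S x))%:E)%E.
  apply: bounded_cvg_integral => //.
  - by move=> n; exact: measurableT_comp.
  - exact: measurableT_comp.
  - by apply: filterS S_S => x Sx; apply: continuous_cvg => //; exact: ch.
have limG : (\int[normal_prob 0 1]_z (h (s_ n * z))%:E @[n --> \oo] -->
    \int[normal_prob 0 1]_z (h (s * z))%:E)%E.
  apply: bounded_cvg_integral => //.
  - by move=> n; apply: measurableT_comp => //; exact: measurable_funM.
  - by apply: measurableT_comp => //; exact: measurable_funM.
  - apply: nearW => z; apply: continuous_cvg; first exact: ch.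
    by apply: cvgM => //; exact: cvg_cst.
rewrite ge0_integral_gauss_law//; apply: (cvg_unique _ limS) => //.
rewrite (_ : (fun n => _) = (fun n => \int[normal_prob 0 1]_z (h (s_ n * z))%:E)%E)//.
apply/funext => n; rewrite -(@ge0_integral_gauss_law _ (s_ n) (fun x => (h x)%:E))//.
exact: (@ge0_integral_has_law _ _ _ _ _ _ (fun x => (h x)%:E)).
Qed.

(** * First and second moments of centered Gaussian laws *)

Section normal_moments.
Context {R : realType}.
Local Notation mu := (@lebesgue_measure R).
Let phi (x : R) : R := normal_pdf 0 1 x.

Let phi_ge0 x : 0 <= phi x. Proof. exact: normal_pdf_ge0. Qed.

Let mphi : measurable_fun [set: R] phi. Proof. exact: measurable_normal_pdf. Qed.

Let phiN x : phi (- x) = phi x.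
Proof. by rewrite /phi !normal_pdf01E sqrrN. Qed.

Let is_derive_phi (x : R) : is_derive x 1 phi (- (x * phi x)).
Proof.
rewrite (_ : phi = fun x => normal_peak 1 * expR (- x ^+ 2 / 2)); last first.
  by apply/funext => y; rewrite /phi normal_pdf01E.
apply: is_derive_eq.
rewrite -![_ *: _]/(_ * _); by field.
Qed.

Let cvg_phi : phi x @[x --> +oo] --> 0.
Proof.
rewrite (_ : phi = fun x => normal_peak 1 * expR (- (x ^+ 2 / 2))); last first.
  by apply/funext => y; rewrite /phi normal_pdf01E mulNr.
rewrite -[X in _ --> X](mulr0 (normal_peak 1)); apply: cvgM; first exact: cvg_cst.
apply: (@cvg_comp _ _ _ (fun x : R => x ^+ 2 / 2) (fun x => expR (- x)) _ +oo); last first.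
  exact: cvgr_expR.
by apply: gt0_cvgMly; [rewrite invr_gt0|exact: cvgr_expr2].
Qed.

Let continuous_phi : continuous phi.
Proof. by apply: continuous_normal_pdf; exact: oner_neq0. Qed.

Let tail_integral z : 0 <= z ->
  (\int[mu]_(t in `[z, +oo[) (t * phi t)%:E = (phi z)%:E)%E.
Proof.
move=> z0; have is_derive_Nphi (x : R) : is_derive x 1 (fun t => - phi t) (x * phi x).
  by apply: is_derive_eq; first exact: is_deriveN; rewrite opprK.
rewrite (@ge0_continuous_FTC2y R _ (fun t => - phi t) z 0)//.
- by rewrite sub0e EFinN oppeK.
- by move=> x zx; rewrite mulr_ge0// (le_trans z0).
- apply: continuous_subspaceT => x.
  by apply: cvgM; [exact: cvg_id|exact: continuous_phi].
- by rewrite -oppr0; apply: cvgN; exact: cvg_phi.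
- by apply: cvgN; apply: cvg_at_right_filter; exact: continuous_phi.
- by move=> x _; rewrite derive1E derive_val.
Qed.

Lemma integral_sqr_normal_pdf :
  (\int[mu]_x (x ^+ 2 * normal_pdf 0 1 x)%:E = 1)%E.
Proof.
(* Tonelli, starting from [phi z] = integral of [t * phi t] over [t >= |z|]. *)
pose D := [set p : R * R | `|p.1| <= p.2].
pose G (p : R * R) : \bar R := ((\1_D p)%:E * (Num.max 0 p.2 * phi p.2)%:E)%E.
have mD : measurable D.
  rewrite (_ : D = (fun p : R * R => `|p.1| <= p.2) @^-1` [set true])//.
  rewrite -[X in measurable X]setTI; apply: measurable_fun_ler => //.
  by apply: measurableT_comp => //; exact: measurable_fst.
have mG : measurable_fun [set: R * R] G.
  apply: emeasurable_funM; first exact/measurable_EFinP/measurable_indic.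
  apply/measurable_EFinP; apply: measurable_funM.
    by apply: measurable_maxr => //; exact: measurable_snd.
  by apply: measurableT_comp => //; exact: measurable_snd.
have G_ge0 p : (0 <= G p)%E.
  by rewrite mule_ge0 ?lee_fin// mulr_ge0// le_max lexx.
have G1 z : (\int[mu]_t G (z, t) = (phi z)%:E)%E.
  transitivity (\int[mu]_(t in `[`|z|%R, +oo[) (t * phi t)%:E)%E; last first.
    rewrite tail_integral//.
    by case: (ger0P z) => _ //; rewrite phiN.
  rewrite [RHS]integral_mkcond; apply: eq_integral => t _.
  rewrite patchE /G indicE/=.
  have [zt|zt] := leP `|z| t.
    rewrite mem_set//= mem_set/= ?in_itv/= ?zt// mul1e max_r//.
    exact: le_trans zt.
  by rewrite memNset/= ?mul0e ?memNset/= ?in_itv/= ?andbT// => /(lt_le_trans zt); rewrite ltxx.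
have G2 t : (\int[mu]_z G (z, t) = 2%:E * (Num.max 0 t ^+ 2 * phi t)%:E)%E.
  rewrite /G/=.
  have DE x : \1_D (x, t) = \1_(`[- t, t]%classic) x :> R.
    rewrite !indicE; congr (nat_of_bool _)%:R.
    by apply/idP/idP => /set_mem H; apply/mem_set; move: H; rewrite /D/= in_itv/= ler_norml.
  under eq_integral do rewrite DE.
  rewrite ge0_integralZr//; last 2 first.
    exact/measurable_EFinP/measurable_indic.
    by rewrite lee_fin mulr_ge0// le_max lexx.
  rewrite integral_indic// setIT [X in (X * _)%E](lebesgue_measure_itv `[- t, t]).
  have [t0|t0] := leP 0 t; last by rewrite expr0n/= !mul0r !mule0.
  rewrite /= lte_fin; case: ltP => tt.
    by rewrite -EFinB -!EFinM; congr EFin; ring.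
  have -> : t = 0 by lra.
  by rewrite expr0n/= !mul0r !mule0.
pose Q (t : R) : R := Num.max 0 t ^+ 2 * phi t.
have Q_ge0 t : 0 <= Q t by rewrite mulr_ge0// sqr_ge0.
have mQ : measurable_fun [set: R] Q.
  by apply: measurable_funM => //; apply: measurable_funX; exact: measurable_maxr.
(* The integrand is split at 0 into [Q x] and its mirror image; by symmetry the two halves have
   equal integrals, which accounts for the factor 2 in [G2]. *)
transitivity (\int[mu]_x ((Q x)%:E + (Q (- x))%:E))%E.
  apply: eq_integral => x _; rewrite -EFinD /Q phiN -mulrDl; congr (_ * _)%:E.
  have [x0|x0] := leP 0 x.
    by rewrite max_l ?oppr_le0// expr0n addr0.
  by rewrite max_r ?oppr_ge0 ?(ltW x0)// sqrrN expr0n add0r.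
have QE : measurable_fun [set: R] (fun x => (Q x)%:E) by exact/measurable_EFinP.
rewrite ge0_integralD//; last 3 first.
- by move=> x _; rewrite lee_fin.
- by move=> x _; rewrite lee_fin.
- by apply: (measurableT_comp QE); exact: oppr_measurable.
have -> : (\int[mu]_x (Q (- x))%:E = \int[mu]_x (Q x)%:E)%E.
  rewrite [RHS](@ge0_integral_affine R (-1) 0)// ?oppr_eq0 ?oner_eq0// normrN1 mul1e.
  by apply: eq_integral => x _; rewrite mulN1r addr0.
rewrite -(integral_normal_pdf (0 : R) 1) -/phi.
under [RHS]eq_integral do rewrite -/(phi _) -G1.
rewrite fubini_tonelli//; under [RHS]eq_integral do rewrite G2.
rewrite ge0_integralZl//; last by move=> x _; exact: Q_ge0.
by rewrite mule_natl mule2n.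
Qed.

End normal_moments.

Section gauss_law_moments.
Context d (T : measurableType d) (R : realType) (P : probability T R).
Context (X : T -> R) (s : R).
Hypotheses (mX : measurable_fun setT X) (lawX : has_law P X (gauss_law s)).

Lemma gauss_law_second_moment : (\int[P]_x (X x ^+ 2)%:E = (s ^+ 2)%:E)%E.
Proof.
have msqr : measurable_fun [set: R] (fun x : R => (x ^+ 2)%:E).
  by apply/measurable_EFinP; exact: measurable_funX.
rewrite (@ge0_integral_has_law _ _ _ _ _ _ (fun x => (x ^+ 2)%:E) mX lawX)//; last first.
  by move=> x; rewrite lee_fin sqr_ge0.
rewrite ge0_integral_gauss_law//; last by move=> x; rewrite lee_fin sqr_ge0.
rewrite integral_normal_prob//; last 2 first.
  by apply/measurable_EFinP; apply: measurable_funX; exact: measurable_funM.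
  by move=> x; rewrite lee_fin sqr_ge0.
transitivity (\int[lebesgue_measure]_x ((s ^+ 2)%:E * (x ^+ 2 * normal_pdf 0 1 x)%:E))%E.
  by apply: eq_integral => x _; rewrite -!EFinM; congr EFin; ring.
rewrite ge0_integralZl//; last 3 first.
  apply/measurable_EFinP; apply: measurable_funM; first exact: measurable_funX.
  exact: measurable_normal_pdf.
  by move=> x _; rewrite lee_fin mulr_ge0 ?sqr_ge0 ?normal_pdf_ge0.
  by rewrite lee_fin sqr_ge0.
by rewrite integral_sqr_normal_pdf mule1.
Qed.

Lemma gauss_law_sqr_integrable : P.-integrable setT (fun x => (X x ^+ 2)%:E).
Proof.
apply/integrableP; split; first by apply/measurable_EFinP; exact: measurable_funX.
under eq_integral do rewrite /= ger0_norm ?sqr_ge0//.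
by rewrite gauss_law_second_moment ltry.
Qed.

Lemma gauss_law_integrable : P.-integrable setT (EFin \o X).
Proof.
(* Domination through [|x| <= 1 + x ^+ 2]. *)
have intD : P.-integrable setT (fun x => 1 + (X x ^+ 2)%:E)%E.
  apply: integrableD => //; last exact: gauss_law_sqr_integrable.
  exact: finite_measure_integrable_cst.
apply: (le_integrable _ _ _ intD) => //; first exact/measurable_EFinP.
move=> x _ /=; rewrite lee_fin [leRHS]ger0_norm ?addr_ge0 ?sqr_ge0//.
by have [|] := ger0P (X x); nra.
Qed.

(** By symmetry of the density, the positive and negative parts have the same integral;
    integrability makes it finite, so the difference is 0. *)
Lemma gauss_law_mean : (\int[P]_x (X x)%:E = 0)%E.
Proof.
pose g (x : R) : \bar R := (Num.max x 0)%:E.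
have g_ge0 x : (0 <= g x)%E by rewrite lee_fin le_max lexx orbT.
have gN_ge0 x : (0 <= (g \o -%R) x)%E by exact: g_ge0.
have mg : measurable_fun [set: R] g.
  by apply/measurable_EFinP; exact: measurable_maxr.
have mgN : measurable_fun [set: R] (g \o -%R) by exact: measurableT_comp.
have gN : (\int[P]_x g (- X x)%R = \int[P]_x g (X x))%E.
  rewrite (@ge0_integral_has_law _ _ _ _ _ _ (g \o -%R) mX lawX)//.
  rewrite (@ge0_integral_has_law _ _ _ _ _ _ g mX lawX)//.
  have mgs : measurable_fun [set: R] (fun z => g (s * z)).
    by apply: measurableT_comp => //; exact: measurable_funM.
  have mgNs : measurable_fun [set: R] (fun z => (g \o -%R) (s * z)).
    by apply: measurableT_comp => //; exact: measurable_funM.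
  rewrite (@ge0_integral_gauss_law R s _ mgN)//.
  rewrite (@ge0_integral_gauss_law R s _ mg)//.
  rewrite (@integral_normal_prob R 0 1 _ mgNs)//.
  rewrite (@integral_normal_prob R 0 1 _ mgs)//.
  rewrite [RHS](@ge0_integral_affine R (-1) 0)// ?oppr_eq0 ?oner_eq0// ?normrN1 ?mul1e.
    apply: eq_integral => x _; rewrite mulN1r addr0 mulrN /=.
    by rewrite !normal_pdf01E sqrrN.
  apply: emeasurable_funM => //.
  by apply/measurable_EFinP; exact: measurable_normal_pdf.
  by move=> x; rewrite mule_ge0// lee_fin normal_pdf_ge0.
rewrite integralE.
have posE : (\int[P]_x ((EFin \o X)^\+ x) = \int[P]_x g (X x))%E.
  by apply: eq_integral => x _; rewrite funeposE /g EFin_max.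
have -> : (\int[P]_x ((fun x => (X x)%:E)^\- x) = \int[P]_x g (X x))%E.
  by rewrite -gN; apply: eq_integral => x _; rewrite funenegE /g EFin_max.
rewrite [X in (X - _)%E]posE subee// -posE integrable_fin_num//.
by apply: integrable_funepos => //; exact: gauss_law_integrable.
Qed.

End gauss_law_moments.

(** * Existence and uniqueness of binary expansions *)

Section binary_digits.
Context {R : realType}.
Implicit Types (t x : R) (b : nat -> bool).

Lemma half_truncn_mul2 x : 0 <= x -> (Num.truncn (2 * x))./2 = Num.truncn x.
Proof.
move=> x0; have /andP[mx xm] := truncn_itv x0.
have /andP[Mx xM] : (Num.truncn (2 * x))%:R <= 2 * x < (Num.truncn (2 * x)).+1%:R.
  by apply: truncn_itv; rewrite mulr_ge0.
set M := Num.truncn (2 * x) in Mx xM *; set m := Num.truncn x in mx xm *.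
have : (m.*2 < M.+1)%N by rewrite -(ltr_nat R) -mul2n natrM; lra.
have : (M < (m.+1).*2)%N by rewrite -(ltr_nat R) -mul2n natrM; lra.
lia.
Qed.

(** [2 ^ n] times the [n]-th partial sum of the expansion [b]. *)
Fixpoint dyadic_floor b n : nat :=
  if n is n'.+1 then b n' + (dyadic_floor b n').*2 else 0.

Lemma dyadic_series b n :
  series (fun i => (b i)%:R * 2^-1 ^+ i.+1 : R) n =
  (dyadic_floor b n)%:R * 2^-1 ^+ n.
Proof.
elim: n => [|n IH]; first by rewrite seriesEnat/= big_nil mul0r.
rewrite seriesEnat/= big_nat_recr//=; move: IH; rewrite seriesEnat/= => ->.
by rewrite natrD -mul2n natrM exprS; field.
Qed.

(** The partial sum [S n] is a multiple of [2^-1 ^+ n] with [S n <= t < S n + 2^-1 ^+ n], so it is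
    read off from a floor of [t]. This gives uniqueness of the expansion. *)
Lemma binexp_floor b t n : 0 <= t < 1 -> is_binexp t b ->
  dyadic_floor b n = Num.truncn (2 ^+ n * t).
Proof.
move=> /andP[t0 t1] [bt /(_ t1) b0].
set S := series _ in bt.
have SS k : S k.+1 = S k + (b k)%:R * 2^-1 ^+ k.+1.
  by rewrite /S seriesEnat/= big_nat_recr.
have S_nd : nondecreasing_seq S.
  apply/nondecreasing_seqP => k; rewrite SS lerDl.
  by rewrite mulr_ge0 ?exprn_ge0 ?invr_ge0.
have tail k j : (k <= j)%N -> S j <= S k + 2^-1 ^+ k - 2^-1 ^+ j.
  elim: j => [|j IH]; first by rewrite leqn0 => /eqP ->; rewrite addrK.
  rewrite leq_eqVlt ltnS => /orP[/eqP->|/IH]; first by rewrite addrK.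
  rewrite SS exprS.
  have : (0 : R) <= 2^-1 ^+ j by rewrite exprn_ge0 ?invr_ge0.
  by case: (b j); rewrite /= ?mulr1n ?mulr0n; lra.
have cS : cvgn S by apply/cvg_ex; exists t.
have St k : S k <= t.
  by rewrite -(cvg_lim _ bt)//; exact: nondecreasing_cvgn_le.
have tS k : t <= S k + 2^-1 ^+ k.
  rewrite -[leLHS](cvg_lim _ bt)//; apply: limr_le => //.
  near=> j; apply: le_trans (tail k j _) _; first by near: j; exact: nbhs_infty_ge.
  by rewrite gerBl exprn_ge0 ?invr_ge0.
have p2 k : 0 < 2^-1 ^+ k :> R by rewrite exprn_gt0 ?invr_gt0.
(* A zero digit at some [i >= n] keeps [t] at least [2^-1 ^+ i.+1] below [S n + 2^-1 ^+ n], making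
   the upper bound strict. *)
have [i ni bi] := b0 n.
have ti : t < S n + 2^-1 ^+ n.
  have := tS i.+1; have := tail _ _ ni; have := p2 i.
  by rewrite SS bi mul0r exprS; lra.
have Sn : S n = (dyadic_floor b n)%:R / 2 ^+ n by rewrite /S dyadic_series exprVn.
have := St n; move: ti; rewrite Sn exprVn -[X in _ < _ + X]mul1r -mulrDl natr1.
rewrite ltr_pdivlMr ?exprn_gt0// ler_pdivrMr ?exprn_gt0// mulrC => ? ?.
by apply/esym/truncn_def/andP.
Unshelve. all: by end_near. Qed.

(** Existence of the expansion, so that [binexp] does not return its default value. The witness
    takes as digits the parities of the floors of [2 ^+ i.+1 * t]. *)
Lemma binexp_is_binexp t : 0 <= t < 1 -> is_binexp t (binexp t).
Proof.
move=> t01; have /andP[t0 t1] := t01.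
pose b i := odd (Num.truncn (2 ^+ i.+1 * t)).
have x0 n : 0 <= 2 ^+ n * t by rewrite mulr_ge0 ?exprn_ge0.
have bE n : dyadic_floor b n = Num.truncn (2 ^+ n * t).
  elim: n => [|n /= ->]; first by rewrite mul1r; apply/esym/truncn_def; rewrite t0.
  by rewrite -(half_truncn_mul2 (x0 n)) mulrA -exprS odd_double_half.
suff : is_binexp t b by move=> bt; rewrite /binexp; exact: (xgetPex _ (ex_intro _ b bt)).
split.
- rewrite (_ : series _ = fun n => (Num.truncn (2 ^+ n * t))%:R * 2^-1 ^+ n); last first.
    by apply/funext => n; rewrite dyadic_series bE.
  have half_cvg : 2^-1 ^+ n @[n --> \oo] --> (0 : R).
    by apply: cvg_expr; rewrite ger0_norm ?invr_ge0// invf_lt1 ?ltr1n.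
  apply: (@squeeze_cvgr _ _ _ _ (fun n => t - 2^-1 ^+ n) (fun=> t)).
  + apply: nearW => n; have /andP[] := truncn_itv (x0 n).
    rewrite exprVn ler_pdivrMr ?exprn_gt0// [t * _]mulrC => -> ?; rewrite andbT.
    rewrite ler_pdivlMr ?exprn_gt0// mulrBl mulVf ?expf_neq0// [t * _]mulrC.
    by rewrite lerBlDr natr1 ltW.
  + by rewrite -[X in _ --> X]subr0; apply: cvgB => //; exact: cvg_cst.
  + exact: cvg_cst.
(* If all digits from [n] on were 1, the gap [e] between [2 ^+ n * t] and the next integer would be
   multiplied by [2 ^+ k] at level [n + k], while staying at most 1. Any [k] with [2 ^+ k] above the
   inverse of [e] contradicts this. *)
- move=> _ n; apply: contrapT => b_true.
  have bi i : (n <= i)%N -> b i = true.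
    by move=> ni; apply/negP => /negP/negbTE bi; apply: b_true; exists i.
  have floorS k : (dyadic_floor b (n + k)).+1 = ((dyadic_floor b n).+1 * 2 ^ k)%N.
    elim: k => [|k IH]; first by rewrite addn0 muln1.
    by rewrite addnS /= bi ?leq_addr// expnS; lia.
  have := truncnS_gt (2 ^+ n * t); rewrite -bE -subr_gt0.
  set e := (_ - _) => e0.
  have [k ke] : exists k : nat, e^-1 < 2 ^+ k.
    exists (Num.truncn e^-1); apply: lt_le_trans (truncnS_gt _) _.
    by rewrite -natrX ler_nat ltn_expl.
  have := truncn_itv (x0 (n + k)%N); rewrite -bE => /andP[+ _].
  have := floorS k => /(congr1 (fun m => m%:R : R));
  rewrite natrM natrX -[(dyadic_floor b (n + k)).+1%:R]natr1 => H.
  have : 1 < 2 ^+ k * e by rewrite mulrC -ltr_pdivrMl// mulr1.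
  by rewrite /e mulrBr mulrA -exprD [(k + n)%N]addnC [_ * _.+1%:R]mulrC -H; lra.
Qed.

Lemma binexp_digit t i : 0 <= t < 1 ->
  binexp t i = odd (Num.truncn (2 ^+ i.+1 * t)).
Proof.
move=> t01; rewrite -(@binexp_floor (binexp t))//; last exact: binexp_is_binexp.
by rewrite /= oddD odd_double addbF oddb.
Qed.

End binary_digits.

(** * Digits near a point *)

Section binary_prefix.
Context {R : realType}.
Implicit Types (s t x : R).

(** The floor function is right-continuous and integer valued, hence constant just to the right of a
    point. *)
Lemma binexp_near_right t i : 0 <= t < 1 ->
  \forall s \near t^'+, binexp s i = binexp t i.
Proof.
move=> t01; have /andP[t0 t1] := t01.
have p2 : 0 < 2 ^+ i.+1 :> R by rewrite exprn_gt0.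
have x0 : 0 <= 2 ^+ i.+1 * t by rewrite mulr_ge0 ?exprn_ge0.
have /andP[mx xm] := truncn_itv x0.
set m := Num.truncn _ in mx xm.
near=> s.
have ts : t < s by [].
have s1 : s < 1 by near: s; exact: nbhs_right_lt.
have sm : s < m.+1%:R / 2 ^+ i.+1.
  by near: s; apply: nbhs_right_lt; rewrite ltr_pdivlMr// mulrC.
rewrite !binexp_digit// ?(ltW (le_lt_trans t0 ts))//; congr odd.
apply: truncn_def; rewrite -/m (le_trans mx) ?ler_pM2l ?(ltW ts)//=.
by rewrite mulrC -ltr_pdivlMr.
Unshelve. all: by end_near. Qed.

Lemma binexp_near_left t i : 0 < t <= 1 ->
  exists c, \forall s \near t^'-, binexp s i = c.
Proof.
move=> /andP[t0 t1].
have p2 : 0 < 2 ^+ i.+1 :> R by rewrite exprn_gt0.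
have x0 : 0 < 2 ^+ i.+1 * t by rewrite mulr_gt0.
(* [m] is the ceiling minus 1, the value of the floor just to the left. It differs from the floor at
   the point itself when [2 ^+ i.+1 * t] is an integer, in particular at [t = 1]. *)
have [m /andP[mx xm]] : exists m : nat, m%:R < 2 ^+ i.+1 * t <= m.+1%:R.
  have /andP[mx xm] := truncn_itv (ltW x0).
  move: mx; rewrite le_eqVlt => /orP[/eqP mx|mx]; last first.
    by exists (Num.truncn (2 ^+ i.+1 * t)); rewrite mx ltW.
  have : (0 < Num.truncn (2 ^+ i.+1 * t))%N by rewrite -(ltr_nat R) mx.
  case: Num.truncn mx => // m <- _; exists m.
  by rewrite ltr_nat ltnSn lexx.
exists (odd m); near=> s.
have st : s < t by [].
have s0 : 0 < s by near: s; exact: nbhs_left_gt.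
have ms : m%:R / 2 ^+ i.+1 < s.
  by near: s; apply: nbhs_left_gt; rewrite ltr_pdivrMr// mulrC.
rewrite binexp_digit ?(ltW s0) ?(lt_le_trans st)//; congr odd; apply: truncn_def.
rewrite mulrC -ler_pdivrMr// (ltW ms)/=.
by apply: lt_le_trans xm; rewrite mulrC ltr_pM2l.
Unshelve. all: by end_near. Qed.

Lemma prefix_near_right t n : 0 <= t < 1 ->
  \forall s \near t^'+, mkseq (binexp s) n = mkseq (binexp t) n.
Proof.
move=> t01; elim: n => [|n IH]; first exact: nearW.
near=> s; rewrite !mkseqS; congr rcons; near: s; first exact: IH.
exact: binexp_near_right.
Unshelve. all: by end_near. Qed.

Lemma prefix_near_left t n : 0 < t <= 1 ->
  exists w, \forall s \near t^'-, mkseq (binexp s) n = w.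
Proof.
move=> t01; elim: n => [|n [w wE]]; first by exists [::]; exact: nearW.
have [c cE] := binexp_near_left n t01.
exists (rcons w c); near=> s; rewrite mkseqS; congr rcons; near: s; first exact: wE.
exact: cE.
Unshelve. all: by end_near. Qed.

End binary_prefix.

(** * Haar functions and path regularity *)

Section cylinders.
Context {R : realType}.

(** The Haar function of the dyadic interval [cyl w]. *)
Definition haar_sign (w : seq bool) (t : R) : R :=
  if mkseq (binexp t) (size w) == w then (-1) ^+ binexp t (size w) else 0.

Lemma cyl_diff (w : seq bool) (t : R) : 0 <= t <= 1 ->
  \1_(cyl (rcons w false)) t - \1_(cyl (rcons w true)) t = haar_sign w t.
Proof.
move=> t01; have mem_cyl c : (t \in cyl (rcons w c)) =
    (mkseq (binexp t) (size w) == w) && (binexp t (size w) == c).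
  apply/idP/idP => [/set_mem[_]|].
    by rewrite size_rcons mkseqS => /rcons_inj[-> ->]; rewrite !eqxx.
  move=> /andP[/eqP e1 /eqP e2]; apply/mem_set; split => //.
  by rewrite size_rcons mkseqS e1 e2.
rewrite !indicE !mem_cyl /haar_sign; case: eqP => /= _; last by rewrite subr0.
by case: binexp; rewrite /= ?subr0 ?sub0r.
Qed.

(** A word of length [k < n] tests the first [k] digits and takes its sign from the next one, so
    only the first [n] digits matter. *)
Lemma Zapprox_prefix (T : Type) (alpha : R) (N : seq bool -> T -> R) n s t x :
  0 <= s <= 1 -> 0 <= t <= 1 -> mkseq (binexp s) n = mkseq (binexp t) n ->
  Zapprox alpha N n s x = Zapprox alpha N n t x.
Proof.
move=> s01 t01 st; apply: eq_bigr => k _; apply: eq_bigr => w _.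
rewrite !cyl_diff//; congr (_ * _ * _).
have stE i : (i < n)%N -> binexp s i = binexp t i.
  by move=> ni; have := congr1 (nth false ^~ i) st; rewrite !nth_mkseq.
rewrite /haar_sign size_tuple stE//.
rewrite (_ : mkseq (binexp s) k = mkseq (binexp t) k)//.
apply/eq_in_map => i; rewrite mem_iota add0n => /andP[_ ik].
by rewrite stE// (ltn_trans ik).
Qed.

End cylinders.

(** With [n] fixed, the truncated series is constant on each side of [t] near [t], with value on the
    right equal to its value at [t]. Right continuity follows with two errors of [e / 2]; on the
    left, [f] stays within [e] of a constant, which is a Cauchy criterion. *)
Lemma limit_cadlag (R : realType) (T : Type) (alpha : R)
    (N : seq bool -> T -> R) (f : R -> R) (x : T) :
  (forall e, 0 < e -> exists n, forall t, 0 <= t <= 1 ->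
    `|Zapprox alpha N n t x - f t| < e) -> cadlag f.
Proof.
move=> Zf; split=> t t01.
- have t01' : 0 <= t <= 1 by case/andP: t01 => -> /ltW ->.
  have [t0 t1] := andP t01.
  apply/cvgrPdist_lt => e e0; have [n Zn] := Zf _ (divr_gt0 e0 (ltr0n R 2)).
  near=> s.
  have s01 : 0 <= s <= 1.
    have ts : t < s by [].
    rewrite (ltW (le_lt_trans t0 ts))/=.
    by near: s; exact: nbhs_right_le.
  have ZE : Zapprox alpha N n s x = Zapprox alpha N n t x.
    apply: Zapprox_prefix => //; near: s; exact: prefix_near_right.
  have := Zn _ t01'; have := Zn _ s01; rewrite ZE !ltr_norml; lra.
- have [t0 t1] := andP t01.
  apply/cauchy_cvgP; apply: cauchy_exP => e e0; have [n Zn] := Zf _ e0.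
  have [w wE] := prefix_near_left n t01.
  have s01 : \forall s \near t^'-, 0 <= s <= 1.
    near=> s; have st : s < t by [].
    rewrite (le_trans (ltW st) t1) andbT.
    by near: s; exact: nbhs_left_ge.
  have F_ws : nbhs t^'- [set s | mkseq (binexp s) n = w /\ 0 <= s <= 1] by exact: filterI.
  have [r [rw r01]] := @filter_ex _ _ (at_left_proper_filter t) _ F_ws.
  exists (Zapprox alpha N n r x); rewrite nbhs_simpl/=; near=> s.
  have sw : mkseq (binexp s) n = w by near: s; exact: wE.
  have s01' : 0 <= s <= 1 by near: s; exact: s01.
  by rewrite /ball/= (@Zapprox_prefix _ _ _ _ _ _ s) ?rw//; exact: Zn.
Unshelve. all: by end_near. Qed.

Lemma uniform_cvg_dist (R : realType) (D : set R) (F : nat -> R -> R) (f : R -> R) :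
  {uniform D, F @ \oo --> f} ->
  forall e, 0 < e -> \forall n \near \oo, forall t, D t -> `|F n t - f t| < e.
Proof.
move=> Ff e e0; apply: (Ff [set g | forall t, D t -> `|g t - f t| < e]).
apply/uniform_nbhs; exists [set p | ball p.1 e p.2]; split.
  exact: (entourage_ball _ (PosNum e0)).
by move=> g /= gf t Dt; rewrite distrC; exact: gf.
Qed.

(** * Length of the common prefix *)

Section jlen.
Context {R : realType}.
Implicit Types s t : R.

Lemma jlen_None s t i : jlen s t = None -> binexp s i = binexp t i.
Proof.
rewrite /jlen; case: asboolP => // st _.
have : [set j | (0 < j)%N] i.+1 by [].
by rewrite -st => -[_]; exact.
Qed.

(** With digits indexed from 0, the number of agreeing leading digits is also the least index [m] of
    disagreement. *)
Lemma jlen_Some s t j : jlen s t = Some j ->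
  (forall i, (i < j)%N -> binexp s i = binexp t i) /\ binexp s j = ~~ binexp t j.
Proof.
rewrite /jlen; case: asboolP => // st [].
have [i st_i] : exists i, binexp s i != binexp t i.
  apply: contrapT => /forallNP st_eq; apply: st; apply/seteqP; split => [k []//|k k0].
  by split=> // i _; have /negP := st_eq i; rewrite negbK => /eqP.
pose ex := ex_intro (fun i => binexp s i != binexp t i) i st_i.
case: (ex_minnP ex) => m st_m m_min.
have lt_m k : (k < m)%N -> binexp s k = binexp t k.
  by move=> km; apply/eqP; apply: contraLR km => /m_min; rewrite -leqNgt.
suff -> : xget 0%N (agree s t `&` ubound (agree s t)) = m.
  by move=> <-; split=> //; move: st_m; case: binexp; case: binexp.
have agree_le k : agree s t k -> (k <= m)%N.
  by move=> [_ st_k]; rewrite leqNgt; apply/negP => /st_k/eqP; rewrite (negbTE st_m).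
(* When [m = 0] the set [agree s t] is empty, and the default value 0 of [xget] is the intended
   maximum. *)
case: xgetP => [k -> [ask ubk]|agree0].
  apply/eqP; rewrite eqn_leq agree_le//=.
  have [->//|m0] := posnP m; apply: (ubk m); split=> // l lm; exact: lt_m.
have [->//|m0] := posnP m; case: (agree0 m); split; first by split.
by move=> k /agree_le.
Qed.

End jlen.

(** The exponent [2 - alpha] is at least 1, so [kappa alpha] is at most [2^-1]. *)
Lemma kappa_bounds (R : realType) (alpha : R) : 0 < alpha <= 1 / 2 ->
  0 < kappa alpha < 1.
Proof.
move=> /andP[a0 a1]; rewrite /kappa powR_gt0 ?invr_gt0//=.
have h1 : 2^-1 `^ (2 - alpha) <= 2^-1 by apply: ge1r_powR; lra.
by apply: le_lt_trans h1 _; lra.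
Qed.

(** * Covariance of the truncated series and its limit *)

Section covariance.
Context {R : realType} (alpha : R).
Implicit Types s t : R.
Local Notation k := (kappa alpha).

Definition haar_coef (w : seq bool) (t : R) : R :=
  2^-1 `^ ((1 - alpha / 2) * (size w)%:R) * haar_sign w t.

Definition limit_cov s t : R :=
  (powo k (omap succn (jlen s t)) - 2 * powo k (jlen s t) + 1) / (1 - k).

Lemma sqr_scale n : (2^-1 `^ ((1 - alpha / 2) * n%:R)) ^+ 2 = k ^+ n :> R.
Proof.
rewrite /kappa -(powR_mulrn 2 (powR_ge0 _ _)) -(powR_mulrn n (powR_ge0 _ _)).
rewrite -!powRrM.
by congr (_ `^ _); field.
Qed.

(** A flat list without repetition turns the double sum over lengths and tuples into one sum over
    indices, the form required by [gaussian_sum_law]. *)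
Fixpoint words n : seq (seq bool) :=
  if n is m.+1 then words m ++ [seq tval w | w <- enum {: m.-tuple bool}] else [::].

Lemma words_size n w : w \in words n -> (size w < n)%N.
Proof.
elim: n => //= n IH; rewrite mem_cat => /orP[/IH/ltnW//|/mapP[u _ ->]].
by rewrite size_tuple.
Qed.

Lemma words_uniq n : uniq (words n).
Proof.
elim: n => //= n IH; rewrite cat_uniq IH/= map_inj_uniq ?enum_uniq ?andbT; last exact: val_inj.
apply/hasPn => _ /mapP[u _ ->]; apply/negP => /words_size.
by rewrite size_tuple ltnn.
Qed.

Lemma Zapprox_words (T : Type) (N : seq bool -> T -> R) n t x : 0 <= t <= 1 ->
  Zapprox alpha N n t x = \sum_(w <- words n) haar_coef w t * N w x.
Proof.
move=> t01; elim: n => [|n IH]; first by rewrite /Zapprox big_ord0 big_nil.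
rewrite /Zapprox big_ord_recr /= -/(Zapprox alpha N n t x) IH big_cat/=; congr (_ + _).
rewrite big_map big_enum; apply: eq_bigr => w _.
by rewrite cyl_diff// /haar_coef size_tuple.
Qed.

(** At length [i] a product is nonzero only for the word that is a prefix of both expansions. Its
    sign is that of the comparison of the next digits. *)
Lemma sum_haar_coef n s t :
  \sum_(w <- words n) haar_coef w s * haar_coef w t =
  \sum_(i < n) (if mkseq (binexp s) i == mkseq (binexp t) i
    then k ^+ i * (-1) ^+ (binexp s i (+) binexp t i) else 0).
Proof.
elim: n => [|n IH]; first by rewrite big_nil big_ord0.
rewrite big_ord_recr /= big_cat/= IH; congr (_ + _).
rewrite big_map big_enum /=.
have termE (w : n.-tuple bool) : haar_coef w s * haar_coef w t =
    if (mkseq (binexp s) n == w) && (mkseq (binexp t) n == w)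
    then k ^+ n * (-1) ^+ (binexp s n (+) binexp t n) else 0.
  rewrite /haar_coef /haar_sign size_tuple mulrACA -expr2 sqr_scale.
  case: eqP => _; last by rewrite mul0r mulr0.
  case: eqP => _; last by rewrite !mulr0.
  by rewrite signr_addb.
case: ifPn => [/eqP st|st]; last first.
  apply: big1 => w _; rewrite termE; case: ifP => // /andP[/eqP sw /eqP tw].
  by rewrite sw tw eqxx in st.
have sz : size (mkseq (binexp s) n) == n by rewrite size_mkseq.
rewrite (bigD1 (Tuple sz))//= big1 => [|w /eqP ws].
  by rewrite addr0 termE -st !eqxx.
by rewrite termE; case: ifP => // /andP[/eqP sw _]; case: ws; exact: val_inj.
Qed.

(** If the prefix length [j] is finite, lengths below [j] contribute [k ^+ i], length [j]
    contributes [- k ^+ j] and longer words nothing, so the sums are eventually constant. If it is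
    infinite, they form a geometric series. *)
Lemma cvg_sum_haar_coef s t : 0 < k < 1 ->
  \sum_(w <- words n) haar_coef w s * haar_coef w t @[n --> \oo] --> limit_cov s t.
Proof.
move=> /andP[k0 k1]; have k1' : 1 - k != 0 by rewrite gt_eqF// subr_gt0.
have prefixP i : (forall m, (m < i)%N -> binexp s m = binexp t m) ->
    mkseq (binexp s) i = mkseq (binexp t) i.
  move=> st; apply/eq_in_map => m; rewrite mem_iota add0n => /andP[_]; exact: st.
under eq_fun do rewrite sum_haar_coef.
rewrite /limit_cov; case jst: (jlen s t) => [j|] /=.
  have [st stj] := jlen_Some jst.
  apply: cvg_near_cst; near=> n.
  have -> : n = (j.+1 + (n - j.+1))%N by rewrite subnKC//; near: n; exact: nbhs_infty_gt.
  elim: (n - j.+1)%N => [|m IH]; last first.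
    rewrite addnS big_ord_recr/= IH -[RHS]addr0; congr (_ + _).
    case: eqP => // /(congr1 (nth false ^~ j)).
    rewrite !nth_mkseq ?leq_addr// stj => /eqP.
    by case: binexp.
  rewrite addn0 big_ord_recr/= prefixP// eqxx stj addNb addbb expr1 mulrN1.
  have -> : \sum_(i < j) (if mkseq (binexp s) i == mkseq (binexp t) i
      then k ^+ i * (-1) ^+ (binexp s i (+) binexp t i) else 0) = \sum_(i < j) k ^+ i.
    apply: eq_bigr => i _; rewrite prefixP => [|l li]; last exact: st (ltn_trans li _).
    by rewrite eqxx st// addbb expr0 mulr1.
  apply: (mulIf k1'); rewrite divfK// mulrBl -[X in X - _]opprK -mulrN opprB.
  by rewrite [_ * (k - 1)]mulrC -subrX1 exprS; ring.
rewrite mulr0 subr0 add0r.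
have st i : binexp s i = binexp t i by exact: jlen_None.
rewrite (_ : (fun n => _) = series (geometric 1 k)); last first.
  apply/funext => n; rewrite /series/= big_mkord; apply: eq_bigr => i _.
  by rewrite prefixP// eqxx st addbb expr0 mulr1 mul1r.
by apply: cvg_geometric_series; rewrite ger0_norm// ltW.
Unshelve. all: by end_near. Qed.

End covariance.

(** The approximating sums are visibly symmetric, and limits are unique; this bypasses the symmetry
    of [jlen]. *)
Lemma limit_covC (R : realType) (alpha s t : R) : 0 < kappa alpha < 1 ->
  limit_cov alpha s t = limit_cov alpha t s.
Proof.
move=> k01; apply: (cvg_unique _ (@cvg_sum_haar_coef _ alpha s t k01)) => //.
rewrite (_ : (fun n => _) = (fun n =>
    \sum_(w <- words n) haar_coef alpha w t * haar_coef alpha w s)).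
  exact: cvg_sum_haar_coef.
by apply/funext => n; apply: eq_bigr => w _; rewrite mulrC.
Qed.

Lemma limit_cov_diag (R : realType) (alpha t : R) :
  limit_cov alpha t t = (1 - kappa alpha)^-1.
Proof.
rewrite /limit_cov; have -> : jlen t t = None.
  rewrite /jlen; case: asboolP => // -[]; apply/seteqP; split=> [j []//|j j0].
  by split.
by rewrite /= mulr0 subr0 add0r mul1r.
Qed.

(** * Laws of linear combinations of the limit process *)

Section limit_process.
Context (R : realType) (d : measure_display) (T : measurableType d)
  (P : probability T R) (alpha : R) (halpha : 0 < alpha <= 1 / 2)
  (N : seq bool -> {RV P >-> R})
  (hN : forall w, has_law P (N w) (normal_prob 0 1))
  (hind : mutually_independent N)
  (Z : R -> {RV P >-> R}) (hZ : limit_process alpha N Z).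

Let k01 : 0 < kappa alpha < 1. Proof. exact: kappa_bounds. Qed.

Definition lincomb_var (n : nat) (t a : 'I_n -> R) : R :=
  \sum_(i < n) \sum_(j < n) a i * a j * limit_cov alpha (t i) (t j).

Lemma cvg_lincomb_var n (t a : 'I_n -> R) :
  \sum_(w <- words m) (\sum_(i < n) a i * haar_coef alpha w (t i)) ^+ 2
    @[m --> \oo] --> lincomb_var t a.
Proof.
rewrite (_ : (fun m => _) = (fun m => \sum_(i < n) \sum_(j < n) a i * a j *
    \sum_(w <- words m) haar_coef alpha w (t i) * haar_coef alpha w (t j))); last first.
  apply/funext => m; under eq_bigr do rewrite expr2 mulr_suml.
  rewrite exchange_big/=; apply: eq_bigr => i _.
  under eq_bigr do rewrite mulr_sumr.
  rewrite exchange_big/=; apply: eq_bigr => j _.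
  by rewrite mulr_sumr; apply: eq_bigr => w _; rewrite mulrACA.
apply: cvg_big => [|i _]; first exact: add_continuous.
apply: cvg_big => [|j _]; first exact: add_continuous.
by apply: cvgM; [exact: cvg_cst|exact: cvg_sum_haar_coef].
Qed.

(** A limit of sums of squares. It allows the square root in the Gaussian law to be undone,
    [Num.sqrt] being 0 on negative numbers. *)
Lemma lincomb_var_ge0 n (t a : 'I_n -> R) : 0 <= lincomb_var t a.
Proof.
rewrite -(cvg_lim _ (@cvg_lincomb_var n t a))//; apply: limr_ge.
  by apply/cvg_ex; exists (lincomb_var t a); exact: (@cvg_lincomb_var n t a).
by apply: nearW => m; apply: sumr_ge0 => w _; exact: sqr_ge0.
Qed.

Lemma lincomb_law n (t a : 'I_n -> R) : (forall i, 0 <= t i <= 1) ->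
  has_law P (fun x => \sum_(i < n) a i * Z (t i) x)
    (gauss_law (Num.sqrt (lincomb_var t a))).
Proof.
(* [A w] is the coefficient of [N w] in the linear combination of truncated series. *)
move=> t01; pose A w := \sum_(i < n) a i * haar_coef alpha w (t i).
apply: (@gaussian_law_limit _ _ _ _ (fun m x => \sum_(w <- words m) A w * N w x) _
  (fun m => Num.sqrt (\sum_(w <- words m) A w ^+ 2))).
- by move=> m; apply: measurable_sum => w; exact: measurable_funM.
- by apply: measurable_sum => i; exact: measurable_funM.
- by move=> m; apply: gaussian_sum_law => //; exact: words_uniq.
- apply: (continuous_cvg _ _ (@cvg_lincomb_var n t a)); exact: sqrt_continuous.
apply: filterS hZ => x Zx.
rewrite (_ : (fun m => _) = (fun m => \sum_(i < n) a i * Zapprox alpha N m (t i) x)).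
  apply: cvg_big => [|i _]; first exact: add_continuous.
  apply: cvgM; first exact: cvg_cst.
  apply/cvgrPdist_lt => e e0; near=> m; rewrite distrC; near: m.
  have := uniform_cvg_dist Zx e0; apply: filterS => m /(_ (t i)); apply.
  by rewrite /= in_itv/=.
apply/funext => m; under [RHS]eq_bigr do rewrite Zapprox_words// mulr_sumr.
rewrite exchange_big/=; apply: eq_bigr => w _.
by rewrite /A mulr_suml; apply: eq_bigr => i _; rewrite mulrA.
Unshelve. all: by end_near. Qed.

Lemma limit_law t : 0 <= t <= 1 ->
  has_law P (Z t) (gauss_law (Num.sqrt (1 - kappa alpha)^-1)).
Proof.
move=> t01; have := @lincomb_law 1 (fun=> t) (fun=> 1) (fun=> t01).
rewrite /lincomb_var !big_ord1 mulr1 mul1r limit_cov_diag.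
by under [X in has_law _ X _]eq_fun do rewrite big_ord1 mul1r.
Qed.

Lemma increment_law s t : 0 <= s <= 1 -> 0 <= t <= 1 ->
  0 <= gamma alpha * powo (kappa alpha) (jlen s t) /\
  has_law P (fun x => Z t x - Z s x)
    (gauss_law (Num.sqrt (gamma alpha * powo (kappa alpha) (jlen s t)))).
Proof.
move=> s01 t01; pose u (i : 'I_2) := if i == ord0 then t else s.
pose a (i : 'I_2) : R := if i == ord0 then 1 else -1.
have u01 i : 0 <= u i <= 1 by rewrite /u; case: ifP.
have := lincomb_law a u01; have := lincomb_var_ge0 u a.
have -> : lincomb_var u a = gamma alpha * powo (kappa alpha) (jlen s t).
  (* The variance is [2 / (1 - k)] minus twice the covariance; the constants cancel and [k ^+ j]
     factors out, leaving [gamma]. *)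
  rewrite /lincomb_var !big_ord_recl !big_ord0 /u /a /= !limit_cov_diag.
  rewrite (limit_covC t s)// /limit_cov /gamma.
  case/andP: k01 => k0 k1.
  by case: jlen => [j|] /=; rewrite ?exprS; field; lra.
by under [X in has_law _ X _]eq_fun do
  rewrite !big_ord_recl big_ord0 /u /a /= mul1r mulN1r addr0.
Qed.

End limit_process.

Theorem theorem2p4 (R : realType) (d : measure_display) (T : measurableType d)
    (P : probability T R) (alpha : R) (halpha : 0 < alpha <= 1 / 2)
    (N : seq bool -> {RV P >-> R})
    (hN : forall w, has_law P (N w) (normal_prob 0 1))
    (hind : mutually_independent N)
    (Z : R -> {RV P >-> R}) (hZ : limit_process alpha N Z) :
  [/\ gaussian_process Z,
      centered_process Z,
      {ae P, forall x, cadlag (fun t => Z t x)},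
      forall s t : R, 0 <= s <= 1 -> 0 <= t <= 1 ->
        'E_P[(fun x => Z t x * Z s x)%R]%E =
        ((powo (kappa alpha) (omap succn (jlen s t))
          - 2 * powo (kappa alpha) (jlen s t) + 1)
         / (1 - kappa alpha))%:E
    & forall s t : R, 0 <= s <= 1 -> 0 <= t <= 1 ->
        'E_P[(fun x => (Z t x - Z s x) ^+ 2)%R]%E =
        (gamma alpha * powo (kappa alpha) (jlen s t))%:E].
Proof.
have k01 := kappa_bounds halpha; have [k0 k1] := andP k01.
have mZ t : measurable_fun setT (Z t) by exact: measurable_funPT.
have k1V : 0 <= (1 - kappa alpha)^-1 by rewrite invr_ge0 subr_ge0 ltW.
have Zlaw := limit_law halpha hN hind hZ.
have Zincr := increment_law halpha hN hind hZ.
have mD s t : measurable_fun setT (fun x => Z t x - Z s x) by exact: measurable_funB.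
have EincrE s t : 0 <= s <= 1 -> 0 <= t <= 1 ->
    (\int[P]_x ((Z t x - Z s x) ^+ 2)%:E =
    (gamma alpha * powo (kappa alpha) (jlen s t))%:E)%E.
  move=> s01 t01; have [g0 lawI] := Zincr s t s01 t01.
  by rewrite (gauss_law_second_moment (mD s t) lawI) sqr_sqrtr.
split.
- move=> n t a t01; exists 0.
  have := lincomb_law halpha hN hind hZ a t01.
  (* Zero variance must give the Dirac alternative of [gaussian_RV], a normal law there having
     positive standard deviation. *)
  have := sqrtr_ge0 (lincomb_var alpha t a); rewrite le_eqVlt => /orP[/eqP <-|v0] law.
    by left => A mA; rewrite (law A mA) gauss_law0.
  right; exists (Num.sqrt (lincomb_var alpha t a)) => // A mA.
  by rewrite (law A mA); exact: gauss_law_normal.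
- by move=> t t01; rewrite unlock; exact: (gauss_law_mean (mZ t) (Zlaw t t01)).
- apply: filterS hZ => x Zx; apply: (@limit_cadlag R T alpha N) => e e0.
  have /filter_ex[n Zn] := uniform_cvg_dist Zx e0.
  by exists n => t t01; apply: Zn; rewrite /= in_itv/=.
- move=> s t s01 t01; rewrite unlock.
  have intZ u : 0 <= u <= 1 -> P.-integrable setT (fun x => (Z u x ^+ 2)%:E).
    by move=> u01; exact: (gauss_law_sqr_integrable (mZ u) (Zlaw u u01)).
  have EZ u : 0 <= u <= 1 -> (\int[P]_x (Z u x ^+ 2)%:E = ((1 - kappa alpha)^-1)%:E)%E.
    by move=> u01; rewrite (gauss_law_second_moment (mZ u) (Zlaw u u01)) sqr_sqrtr.
  have intD : P.-integrable setT (fun x => ((Z t x - Z s x) ^+ 2)%:E).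
    exact: (gauss_law_sqr_integrable (mD s t) (Zincr s t s01 t01).2).
  (* Polarization: the product is half of the two squares minus the squared increment, and each of
     these three has a known finite integral. *)
  transitivity (\int[P]_x ((2^-1)%:E * ((Z t x ^+ 2)%:E + (Z s x ^+ 2)%:E
      - ((Z t x - Z s x) ^+ 2)%:E)))%E.
    by apply: eq_integral => x _; rewrite -EFinD -EFinM; congr EFin; field.
  have intS : P.-integrable setT (fun x => (Z t x ^+ 2)%:E + (Z s x ^+ 2)%:E)%E.
    by apply: integrableD => //; exact: intZ.
  rewrite integralZl//; last exact: integrableB.
  rewrite integralB//.
  rewrite integralD//; [|exact: intZ|exact: intZ].
  rewrite !EZ// EincrE// -EFinD -EFinM /gamma; congr EFin.
  by case: jlen => [j|] /=; rewrite ?exprS; field; lra.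
- by move=> s t s01 t01; rewrite unlock; exact: EincrE.
Qed.
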